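(* For each integer $k\ge 3$, there are infinitely many (pairwise non-isomorphic) graphs $G$ such that $P(G,k)=P_{\ell}(G,k)>0$ and $P(G,k+1)>P_{\ell}(G,k+1)$.
   Context: All graphs are finite and simple. $\mathbb{N}$ denotes the set of positive integers and $[k]=\{1,\dots,k\}$. A proper coloring of a graph $G$ is a map $\theta:V(G)\to\mathbb{N}$ with $\theta(u)\ne\theta(v)$ for all $uv\in E(G)$. For $k\in\mathbb{N}$, $P(G,k)$ (the chromatic polynomial) is the number of proper colorings $\theta$ of $G$ with $\theta(v)\in[k]$ for all $v\in V(G)$. A list assignment $L$ of $G$ assigns to each vertex $v$ a subset $L(v)\subseteq\mathbb{N}$; it is a $k$-list assignment if $|L(v)|=k$ for all $v\in V(G)$. An $L$-coloring is a proper coloring $\theta$ with $\theta(v)\in L(v)$ for all $v$, and $P(G,L)$ is the number of $L$-colorings of $G$. The list-color function $P_{\ell}(G,k)$ is the minimum of $P(G,L)$ over all $k$-list assignments $L$ of $G$. *)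

(* Defs.v *)
From HB Require Import structures.
From mathcomp Require Import all_boot finmap boolp.

Set Implicit Arguments.
Unset Strict Implicit.
Unset Printing Implicit Defensive.

Local Open Scope fset_scope.

Record sgraph := SGraph {
  vertex :> finType;
  edge : rel vertex;
  edge_sym : symmetric edge;
  edge_irr : irreflexive edge
}.

Definition isomorphic (G H : sgraph) : Prop :=
  exists f : G -> H,
    bijective f /\ forall u v : G, edge (f u) (f v) = edge u v.

Definition proper_coloring (G : sgraph) (theta : G -> nat) : bool :=
  [forall u : G, forall v : G, edge u v ==> (theta u != theta v)].

(* P(G, L).  The maps theta with theta v \in L v are encoded as dependent
   functions into the finite types underlying the lists. *)
Definition nb_list_colorings (G : sgraph) (L : G -> {fset nat}) : nat :=
  #|[set theta : {dffun forall v : G, L v}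
      | proper_coloring (fun v : G => val (theta v))]|.

Definition palette (k : nat) : {fset nat} := [fset i in iota 1 k].

Definition chromatic_poly (G : sgraph) (k : nat) : nat :=
  nb_list_colorings (fun _ : G => palette k).

(* Colors are positive integers, hence the exclusion of 0. *)
Definition k_list_assignment (G : sgraph) (k : nat) (L : G -> {fset nat}) : Prop :=
  forall v : G, 0 \notin L v /\ #|` L v| = k.

Lemma palette_list_assignment (G : sgraph) (k : nat) :
  k_list_assignment k (fun _ : G => palette k).
Proof.
move=> v; split; first by rewrite !inE mem_iota.
by rewrite /palette card_fseq undup_id ?iota_uniq // size_iota.
Qed.

Definition nb_list_colorings_attained (G : sgraph) (k : nat) : pred nat :=
  fun m => `[< exists L : G -> {fset nat},
                 k_list_assignment k L /\ nb_list_colorings L = m >].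

Lemma nb_list_colorings_attained_ex (G : sgraph) (k : nat) :
  exists m, nb_list_colorings_attained G k m.
Proof.
exists (chromatic_poly G k); apply/asboolP.
exists (fun _ => palette k); split=> //; exact: palette_list_assignment.
Qed.

Definition list_color_fun (G : sgraph) (k : nat) : nat :=
  ex_minn (nb_list_colorings_attained_ex G k).

(* Main.v *)
(* Let [gadget k n] consist of a clique Q on k-1 vertices, two vertices u, u'
   joined to all of Q, a vertex w joined to u', and n vertices joined to u and w.
   Coloring the vertices in this order from lists of size k, each vertex leaves at
   least k - d choices, where d is its number of earlier neighbors.  With constant
   lists of size k the bound is attained at every step: u and u' are forced to
   agree, so u and w get different colors.  Hence P = P_l at k.
   With K = k+1 colors, u and w may agree, so the constant lists have at least
   (K-1)^n colorings.  If instead u and w get disjoint lists A and B, and the lists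
   A - a + b for (a, b) in A x B are spread evenly over the n vertices, then for
   every choice of colors on u and w the geometric mean of the numbers of choices
   left is below K-1, because K(K-2) < (K-1)^2.  So this assignment has
   exponentially fewer colorings when n is large. *)
Require Import Defs.
From HB Require Import structures.
From mathcomp Require Import all_boot finmap boolp.
From mathcomp Require Import zify.

Set Implicit Arguments.
Unset Strict Implicit.
Unset Printing Implicit Defensive.

(** * Counting the colors left after removing those of the neighbors *)

Lemma size_filter_notin (T : eqType) (l t : seq T) : uniq l -> uniq t ->
  size [seq c <- l | c \notin t] + size [seq c <- t | c \in l] = size l.
Proof.
move=> ul ut.
have -> : size [seq c <- t | c \in l] = size [seq c <- l | c \in t].
  apply/perm_size/uniq_perm; rewrite ?filter_uniq // => c.
  by rewrite !mem_filter andbC.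
by rewrite !size_filter addnC count_predC.
Qed.

Lemma leq_size_filter_notin (T : eqType) (l t : seq T) : uniq l ->
  size l - size t <= size [seq c <- l | c \notin t].
Proof.
move=> ul; rewrite leq_subLR addnC.
have -> : [seq c <- l | c \notin t] = [seq c <- l | c \notin undup t].
  by apply: eq_filter => c; rewrite mem_undup.
rewrite -(size_filter_notin ul (undup_uniq t)) leq_add2l.
by rewrite size_filter (leq_trans (count_size _ _)) ?size_undup.
Qed.

(** * Colorings of an ordered graph, built vertex by vertex *)

Section OrderedGraph.
(** Edges are recorded at their later endpoint. Indexing by [nat] rather than by vertices lets the
    induction on the number of vertices reuse the same neighbors and lists. *)
Variable nbr : nat -> seq nat.
Hypothesis nbr_lt : forall i j : nat, j \in nbr i -> j < i.

Definition ordered_edge (m : nat) : rel 'I_m :=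
  fun u v => (val u \in nbr v) || (val v \in nbr u).

Lemma ordered_edge_sym m : symmetric (@ordered_edge m).
Proof. by move=> u v; rewrite /ordered_edge orbC. Qed.

Lemma ordered_edge_irr m : irreflexive (@ordered_edge m).
Proof.
by move=> u; rewrite /ordered_edge orbb; apply/negP => /nbr_lt; rewrite ltnn.
Qed.

Definition ordered_graph (m : nat) : sgraph :=
  SGraph (@ordered_edge_sym m) (@ordered_edge_irr m).

Section Lists.
Variable L : nat -> {fset nat}.

(* The sequence [s] is read as a coloring of the vertices below [size s]. *)
Definition choices (s : seq nat) : seq nat :=
  [seq c <- L (size s) | c \notin map (nth 0 s) (nbr (size s))].

Fixpoint colorings (n : nat) : seq (seq nat) :=
  if n is n'.+1 then [seq rcons s c | s <- colorings n', c <- choices s]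
  else [:: [::]].

Definition valid (s : seq nat) : Prop :=
  forall i, i < size s -> nth 0 s i \in choices (take i s).

Lemma valid_rcons s c : valid (rcons s c) <-> valid s /\ c \in choices s.
Proof.
split=> [vs | [vs cs] i].
  split=> [i lis|]; last first.
    have := vs (size s); rewrite size_rcons ltnSn nth_rcons ltnn eqxx.
    by rewrite -cats1 take_size_cat //; apply.
  have := vs i; rewrite size_rcons nth_rcons lis -cats1 takel_cat 1?ltnW //.
  by apply.
rewrite size_rcons ltnS leq_eqVlt => /predU1P[->|lis].
  by rewrite nth_rcons ltnn eqxx -cats1 take_size_cat.
by rewrite nth_rcons lis -cats1 takel_cat 1?ltnW //; apply: vs.
Qed.

Lemma mem_colorings n s : s \in colorings n <-> size s = n /\ valid s.
Proof.
elim: n s => [|n IHn] s /=.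
  rewrite inE; split=> [/eqP -> //|[/size0nil -> //]].
case/lastP: s => [|s c].
  split=> [/allpairsPdep[x [y [_ _]]]|[]//].
  by move/(congr1 size); rewrite size_rcons.
rewrite size_rcons; split=> [/allpairsPdep[x [y [xn yx]]]|].
  move/rcons_inj => [-> ->]; case/IHn: xn => <- vx.
  by split=> //; apply/valid_rcons.
case=> -[sn] /valid_rcons[vs cs].
by apply/allpairsPdep; exists s, c; split=> //; apply/IHn.
Qed.

Lemma colorings_uniq n : uniq (colorings n).
Proof.
elim: n => //= n IHn; apply: allpairs_uniq_dep => //.
  by move=> s _; rewrite filter_uniq ?fset_uniq.
by move=> [s c] [s' c'] _ _ /= /rcons_inj[-> ->].
Qed.

Lemma size_colorings_geq n (d : nat -> nat) :
  (forall s, size s < n -> valid s -> d (size s) <= size (choices s)) ->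
  \prod_(i < n) d i <= size (colorings n).
Proof.
elim: n => [|n IHn] dP /=; first by rewrite big_ord0.
rewrite big_ord_recr /= size_allpairs_dep sumnE big_map.
apply: (@leq_trans (\sum_(s <- colorings n) d n)).
  rewrite big_const_seq count_predT iter_addn_0 mulnC leq_mul2l.
  by apply/orP; right; apply: IHn => s sn; apply: dP; exact: leqW.
rewrite big_seq [leqRHS]big_seq; apply: leq_sum => s /mem_colorings[sn vs].
by rewrite -sn; apply: dP; rewrite ?sn.
Qed.

Lemma size_colorings_leq n (d : nat -> nat) :
  (forall s, size s < n -> valid s -> size (choices s) <= d (size s)) ->
  size (colorings n) <= \prod_(i < n) d i.
Proof.
elim: n => [|n IHn] dP /=; first by rewrite big_ord0.
rewrite big_ord_recr /= size_allpairs_dep sumnE big_map.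
apply: (@leq_trans (\sum_(s <- colorings n) d n)).
  rewrite big_seq [leqRHS]big_seq; apply: leq_sum => s /mem_colorings[sn vs].
  by rewrite -sn; apply: dP; rewrite ?sn.
rewrite big_const_seq count_predT iter_addn_0 mulnC leq_mul2r.
by apply/orP; right; apply: IHn => s sn; apply: dP; exact: leqW.
Qed.

(** When the number of choices at each later vertex depends only on the colors of the first [b]
    vertices, the extensions of a fixed prefix are counted by a product. *)
Lemma size_colorings_extend b n (w : seq nat -> nat -> nat) :
  (forall s i, i < n -> size s = b + i -> valid s ->
     size (choices s) = w (take b s) i) ->
  size (colorings (b + n)) = \sum_(s <- colorings b) \prod_(i < n) w s i.
Proof.
move=> wP.
(* An arbitrary weight [F] on prefixes makes the induction work: the factor of the last vertex is
   absorbed into [F]. *)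
suff: forall F : seq nat -> nat, \sum_(s <- colorings (b + n)) F (take b s)
      = \sum_(s <- colorings b) F s * \prod_(i < n) w s i.
  move/(_ (fun=> 1)); rewrite sum1_size => ->.
  by apply: eq_bigr => s _; rewrite mul1n.
elim: n wP => [|n IHn] wP F.
  rewrite addn0 big_seq [RHS]big_seq; apply: eq_bigr => s /mem_colorings[<- _].
  by rewrite take_size big_ord0 muln1.
rewrite addnS /= big_allpairs_dep /=.
under [RHS]eq_bigr => s _ do rewrite big_ord_recr /= mulnA mulnAC.
rewrite -(IHn _ (fun s => F s * w s n)); last first.
  by move=> s i lin; apply: wP; exact: ltnW.
rewrite big_seq [RHS]big_seq; apply: eq_bigr => s /mem_colorings[sbn vs].
rewrite -(wP s n) // big_seq_cond.
under eq_bigr => c _ do rewrite -cats1 takel_cat ?sbn ?leq_addr //.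
by rewrite -big_seq_cond big_const_seq count_predT iter_addn_0.
Qed.

Lemma valid_mem s i : valid s -> i < size s -> nth 0 s i \in L i.
Proof.
move=> vs lis; have := vs i lis.
by rewrite mem_filter size_takel 1?ltnW // => /andP[].
Qed.

Lemma valid_neq s i j : valid s -> i < size s -> j \in nbr i ->
  nth 0 s j != nth 0 s i.
Proof.
move=> vs lis ji; have := vs i lis.
rewrite mem_filter size_takel 1?ltnW // => /andP[+ _].
by apply: contra => /eqP <-; apply/mapP; exists j; rewrite ?nth_take ?nbr_lt.
Qed.

Lemma nb_list_colorings_ordered n :
  nb_list_colorings (fun v : ordered_graph n => L (val v)) =
  size (colorings n).
Proof.
rewrite /nb_list_colorings.
set S := [set _ | _].
pose g (th : {dffun forall v : ordered_graph n, L (val v)}) : seq nat :=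
  [seq val (th v) | v <- enum 'I_n].
have szg th : size (g th) = n by rewrite size_map size_enum_ord.
have nthg th (v : 'I_n) : nth 0 (g th) v = val (th v).
  by rewrite (nth_map v) ?size_enum_ord // nth_ord_enum.
have g_inj : injective g.
  move=> th th' eqg; apply/ffunP => v; apply/val_inj.
  by rewrite -!nthg eqg.
rewrite cardE -(size_map g); apply/perm_size/uniq_perm.
- by rewrite map_inj_uniq ?enum_uniq.
- exact: colorings_uniq.
(* Neighbors precede [i], so their colors can be read in [s] as well as in its prefix. *)
have memch (s : seq nat) i : size s = n -> i < n ->
    (nth 0 s i \in choices (take i s)) =
    (nth 0 s i \in L i) && (nth 0 s i \notin map (nth 0 s) (nbr i)).
  move=> sn lin; rewrite mem_filter size_takel ?sn 1?ltnW // andbC.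
  congr (_ && ~~ _); congr (_ \in _); apply/eq_in_map => j /nbr_lt ji.
  by rewrite nth_take.
move=> s; apply/mapP/idP => [[th]|].
  rewrite mem_enum inE => /'forall_forallP pr ->.
  apply/mem_colorings; split=> // i; rewrite szg => lin.
  rewrite memch //= -[i]/(val (Ordinal lin)) nthg (valP (th _)) /=.
  apply/mapP => -[j jn eqj]; have ji := nbr_lt jn.
  have ljn := ltn_trans ji lin.
  have := pr (Ordinal ljn) (Ordinal lin).
  rewrite /= /ordered_edge jn /= => /eqP; apply.
  by rewrite eqj -[j]/(val (Ordinal ljn)) nthg.
case/mem_colorings => sn vs.
have mem_L (v : ordered_graph n) : nth 0 s (val v) \in L (val v).
  by have := vs (val v); rewrite sn memch ?ltn_ord // => /(_ isT)/andP[].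
pose th : {dffun forall v : ordered_graph n, L (val v)} :=
  [ffun v : ordered_graph n => FSetSub (mem_L v)].
exists th.
  rewrite mem_enum inE; apply/'forall_forallP => u v; rewrite !ffunE /=.
  have ne (x y : 'I_n) : val x \in nbr y -> nth 0 s x != nth 0 s y.
    move=> xy; have := vs y; rewrite sn memch ?ltn_ord // => /(_ isT)/andP[_].
    by apply: contra => /eqP <-; apply: map_f.
  by apply/implyP => /orP[/ne //|/ne]; rewrite eq_sym.
apply: (@eq_from_nth _ 0); rewrite ?szg // => i; rewrite sn => lin.
by rewrite -[i]/(val (Ordinal lin)) nthg ffunE.
Qed.

End Lists.
End OrderedGraph.

(** * The gadget and its earlier neighbors *)

(* Earlier neighbors of [i] in the graph described at the top of the file:
   Q is [0, ..., k-2], and u, u', w are [k-1], [k], [k+1]. *)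
Definition nbrs (k i : nat) : seq nat :=
  if i < k then iota 0 i
  else if i == k then iota 0 k.-1
  else if i == k.+1 then [:: k]
  else [:: k.-1; k.+1].

Lemma nbrs_lt k i j : j \in nbrs k i -> j < i.
Proof.
rewrite /nbrs; case: (ltngtP i k) => [lik|lki|->]; rewrite ?mem_iota //.
  case: eqP => [->|nik]; rewrite !inE; first by move/eqP->.
  by case/orP => /eqP ->; lia.
by lia.
Qed.

Definition gadget (k n : nat) : sgraph := ordered_graph (@nbrs_lt k) (k.+2 + n).

Lemma size_nbrs_lt k i : 2 < k -> size (nbrs k i) < k.
Proof.
move=> k2; rewrite /nbrs; case: (ltngtP i k) => [lik|lki|_].
- by rewrite size_iota.
- by case: eqP => _ /=; lia.
- by rewrite size_iota; lia.
Qed.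

Lemma nbrs_uniq k i : uniq (nbrs k i).
Proof.
rewrite /nbrs; do ! [case: ifP => _]; rewrite ?iota_uniq //=.
by rewrite inE andbT; lia.
Qed.

(** Vertices 0 to k form a complete graph without the edge between u and u', the only pair among
    them whose indices sum to k + (k-1). *)
Lemma mem_nbrs_clique k i j : j < i -> i <= k -> i + j != k + k.-1 ->
  j \in nbrs k i.
Proof.
rewrite /nbrs => ji; case: (ltngtP i k) => // [lik|eik] _ ne; rewrite mem_iota //.
by lia.
Qed.

(** * Equality of the two functions at k *)

Lemma nb_list_colorings_gadget_geq k n (L : gadget k n -> {fset nat}) :
  k_list_assignment k L ->
  \prod_(i < k.+2 + n) (k - size (nbrs k i)) <= nb_list_colorings L.
Proof.
(* Indices that are not vertices get the empty list; they are never colored. *)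
move=> Lk; pose L' i := oapp L fset0 (insub i).
have -> : L = fun v : gadget k n => L' (val v).
  by apply/funext => v; rewrite /L' valK.
rewrite nb_list_colorings_ordered.
apply: (size_colorings_geq (d := fun i => k - size (nbrs k i))) => s ltsn _.
rewrite /choices -(size_map (nth 0 s)).
have -> : k = size (L' (size s)).
  by rewrite /L' insubT /=; case: (Lk (Sub (size s) ltsn)).
exact/leq_size_filter_notin/fset_uniq.
Qed.

Lemma mem_palette k c : (c \in palette k) = (0 < c <= k).
Proof. by rewrite !inE mem_iota add1n ltnS. Qed.

Lemma card_palette k : #|` palette k| = k.
Proof. by rewrite card_fseq undup_id ?iota_uniq // size_iota. Qed.

Lemma nth_neq_inj (s : seq nat) l :
  (forall i j, j < i -> i < l -> nth 0 s j != nth 0 s i) ->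
  {in iota 0 l &, injective (nth 0 s)}.
Proof.
move=> ne i j; rewrite !mem_iota !add0n /= => il jl eqij.
by case: (ltngtP i j) => // [ij|ji]; [have := ne _ _ ij jl|have := ne _ _ ji il];
  rewrite eqij eqxx.
Qed.

(* The colors of u and u' both avoid the k-1 colors of Q, hence agree, and w is
   adjacent to u'. *)
Lemma valid_nbrs_inj k s : valid (nbrs k) (fun=> palette k) s ->
  {in nbrs k (size s) &, injective (nth 0 s)}.
Proof.
move=> vs.
have ne i j : j < i -> i < size s -> i <= k -> i + j != k + k.-1 ->
    nth 0 s j != nth 0 s i.
  move=> ji lis ik nij.
    by apply: (valid_neq _ vs lis); [exact: nbrs_lt|exact: mem_nbrs_clique].
rewrite /nbrs; case: (ltngtP (size s) k) => [sk|ks|sk].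
- by apply: nth_neq_inj => i j ji lis; apply: ne => //; lia.
- case: eqP => [_ i j|nks]; first by rewrite !inE => /eqP-> /eqP->.
  have {nks}ks : k.+1 < size s by lia.
  have eqk : nth 0 s k.-1 = nth 0 s k.
    apply/eqP; apply/negPn/negP => nek.
    have /map_inj_in_uniq inj : {in iota 0 k.+1 &, injective (nth 0 s)}.
      apply: nth_neq_inj => i j ji lik.
      have [e|nij] := eqVneq (i + j) (k + k.-1); last by apply: ne => //; lia.
      by have [-> ->] : i = k /\ j = k.-1 by lia.
    have: size (map (nth 0 s) (iota 0 k.+1)) <= size (palette k).
      apply: uniq_leq_size => [|c /mapP[i]]; first by rewrite inj iota_uniq.
      by rewrite mem_iota => lik ->; apply: (valid_mem vs); lia.
    by rewrite size_map size_iota card_palette ltnn.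
  have nek : nth 0 s k.-1 != nth 0 s k.+1.
    rewrite eqk; apply: (valid_neq (@nbrs_lt k) vs ks).
    by rewrite /nbrs ltnNge leqnSn /= gtn_eqF // eqxx inE.
  move=> i j; rewrite !inE => /orP[]/eqP-> /orP[]/eqP-> //;
    by move=> e; move: nek; rewrite e eqxx.
- by apply: nth_neq_inj => i j ji lis; apply: ne; lia.
Qed.

(** The greedy lower bound is attained: earlier neighbors have distinct colors, all in the palette,
    so each removes exactly one choice. *)
Lemma chromatic_poly_gadget k n :
  chromatic_poly (gadget k n) k = \prod_(i < k.+2 + n) (k - size (nbrs k i)).
Proof.
apply/eqP; rewrite eqn_leq; apply/andP; split; last first.
  exact/nb_list_colorings_gadget_geq/palette_list_assignment.
rewrite /chromatic_poly (nb_list_colorings_ordered _ (fun=> palette k)).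
apply: (size_colorings_leq (d := fun i => k - size (nbrs k i))) => s _ vs.
rewrite /choices; set t := map _ _.
have ut : uniq t by rewrite (map_inj_in_uniq (valid_nbrs_inj vs)) nbrs_uniq.
have /all_filterP tk : all (mem (palette k)) t.
  apply/allP => c /mapP[i /nbrs_lt lis ->]; exact: (valid_mem vs).
have := size_filter_notin (fset_uniq (palette k)) ut.
by rewrite tk card_palette size_map => /(canRL (addnK _)) ->.
Qed.

(** * Lower bound for constant lists of size k+1 *)

Lemma nbrs_join k i : nbrs k (k.+2 + i) = [:: k.-1; k.+1].
Proof. by rewrite /nbrs !ifF //; lia. Qed.

Lemma valid_palette_iota k l : l <= k.+1 ->
  valid (nbrs k) (fun=> palette k.+1) (iota 1 l).
Proof.
move=> lk i; rewrite size_iota => il.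
rewrite mem_filter nth_iota // mem_palette take_iota (minn_idPl (ltnW il)).
rewrite size_iota andbC; apply/andP; split; first by lia.
apply/mapP => -[j /nbrs_lt ji]; rewrite nth_iota //; lia.
Qed.

(** A single coloring of the first k+2 vertices in which u and w agree already has [k ^ n]
    extensions. *)
Lemma chromatic_poly_gadgetS_geq k n : 0 < k ->
  k ^ n <= chromatic_poly (gadget k n) k.+1.
Proof.
move=> k_gt0.
rewrite /chromatic_poly (nb_list_colorings_ordered _ (fun=> palette k.+1)).
(* [undup] makes a color shared by u and w count once. *)
pose w (s : seq nat) (_ : nat) :=
  k.+1 - size (undup [:: nth 0 s k.-1; nth 0 s k.+1]).
rewrite (@size_colorings_extend _ _ _ _ w) => [|s i _ si vs]; last first.
  rewrite /w; set t := undup _.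
  have -> : choices (nbrs k) (fun=> palette k.+1) s =
      [seq c <- palette k.+1 | c \notin t].
    apply: eq_filter => c; rewrite si nbrs_join mem_undup /=.
    by rewrite !nth_take //; lia.
  have /all_filterP tk : all (mem (palette k.+1)) t.
    apply/allP => c; rewrite mem_undup in_cons mem_seq1.
    rewrite !nth_take; try lia.
    by case/orP => /eqP->; apply: (valid_mem vs); lia.
  have := size_filter_notin (fset_uniq (palette k.+1)) (undup_uniq _ : uniq t).
  by rewrite tk card_palette => /(canRL (addnK _)).
(* Vertices 0 to k get the distinct colors 1 to k+1. Then w repeats the color k of u, which is
   allowed since its only earlier neighbor u' has color k+1. *)
pose s0 := rcons (iota 1 k.+1) k.
have s0P : s0 \in colorings (nbrs k) (fun=> palette k.+1) k.+2.
  apply/mem_colorings; rewrite size_rcons size_iota; split=> //.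
  apply/valid_rcons; split; first exact: valid_palette_iota.
  rewrite mem_filter mem_palette size_iota.
  have -> : nbrs k k.+1 = [:: k] by rewrite /nbrs ltnNge leqnSn /= gtn_eqF // eqxx.
  by rewrite [map _ _]/map nth_iota // inE; lia.
rewrite (bigD1_seq s0) ?colorings_uniq //=.
apply: leq_trans (leq_addr _ _).
rewrite -[n in _ ^ n]card_ord -prod_nat_const /=; apply: leq_prod => i _.
have -> : w s0 i = k.+1 - size (undup [:: k; k]).
  rewrite /w /s0 !nth_rcons size_iota ltnn eqxx ifT; last lia.
  by rewrite nth_iota ?add1n ?prednK //; lia.
by rewrite /= inE eqxx subn1.
Qed.

Lemma prod_one_exception (r : seq nat) x p q : uniq r -> x \in r ->
  \prod_(a <- r) (if a == x then p else q) = p * q ^ (size r).-1.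
Proof.
move=> ur xr; rewrite (bigD1_seq x) //= eqxx; congr (_ * _).
rewrite (eq_bigr (fun=> q)) => [|a /negPf-> //].
rewrite big_const_seq iter_muln_1 -(size_filter (predC1 x)) -rem_filter //.
by rewrite size_rem.
Qed.

(** * Lists of size k+1 with few colorings *)

Definition swap_lists (k N : nat) : seq {fset nat} :=
  flatten (nseq N [seq (b |` (palette k.+1 `\ a))%fset
                  | a <- iota 1 k.+1, b <- iota k.+2 k.+1]).

(** Here A, the palette, also serves Q and u', and B is the interval from k+2 to 2k+2. The default
    of [nth] keeps [bad_listsP] true at every index. *)
Definition bad_lists (k N i : nat) : {fset nat} :=
  if i < k.+1 then palette k.+1
  else if i == k.+1 then [fset c in iota k.+2 k.+1]%fset
  else nth (palette k.+1) (swap_lists k N) (i - k.+2).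

Lemma size_swap_lists k N : size (swap_lists k N) = N * (k.+1 * k.+1).
Proof.
rewrite size_flatten /shape map_nseq sumn_nseq size_allpairs !size_iota.
by rewrite mulnC.
Qed.

Lemma bad_lists_swap k N i :
  bad_lists k N (k.+2 + i) = nth (palette k.+1) (swap_lists k N) i.
Proof. by rewrite /bad_lists !ifF ?addKn //; lia. Qed.

Lemma bad_listsP k N i : 0 \notin bad_lists k N i /\ #|` bad_lists k N i| = k.+1.
Proof.
have pP : 0 \notin palette k.+1 /\ #|` palette k.+1| = k.+1.
  by rewrite mem_palette card_palette.
rewrite /bad_lists; case: ifP => // _; case: ifP => _.
  by rewrite !inE mem_iota card_fseq undup_id ?iota_uniq ?size_iota.
have [lt|le] := ltnP (i - k.+2) (size (swap_lists k N)); last by rewrite nth_default.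
have /flattenP[r /nseqP[-> _]] := mem_nth (palette k.+1) lt.
move=> /allpairsP[[a b] []]; rewrite ![_.1]/= ![_.2]/= !mem_iota => aP bP ->; split.
  by rewrite in_fset1U in_fsetD1 mem_palette; lia.
rewrite cardfsU1 in_fsetD1 mem_palette.
have := cardfsD1 a (palette k.+1); rewrite mem_palette card_palette; lia.
Qed.

(* The product of the numbers of choices left over one round of the lists
   A - a + b, the same for all colors of u in A and w in B. *)
Definition swap_weight (k : nat) : nat :=
  (k * k.+1 ^ k) * (k.-1 * k ^ k) ^ k.

(** Once the common factor [k * k ^ (k * k)] is cancelled, what remains is (k+1)(k-1) < k * k,
    raised to the power k. *)
Lemma swap_weight_lt k : 1 < k -> 0 < swap_weight k < k ^ (k.+1 * k.+1).
Proof.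
move=> k1; rewrite /swap_weight !muln_gt0 !expn_gt0 !muln_gt0 !expn_gt0.
apply/andP; split; first by lia.
have -> : k ^ (k.+1 * k.+1) = k * k ^ (k * k) * (k * k) ^ k.
  by rewrite expnMn -expnS -!expnD; congr (_ ^ _); lia.
rewrite expnMn -expnM.
have -> : k * k.+1 ^ k * (k.-1 ^ k * k ^ (k * k)) =
   k * k ^ (k * k) * (k.+1 * k.-1) ^ k by rewrite expnMn; lia.
rewrite ltn_pmul2l ?ltn_exp2r; lia.
Qed.

(** The list A - a + b misses x only if a = x and contains y only if b = y. So in the row a = x the
    factors are k+1, except for one k; in each of the k other rows they are k, except for one
    k-1. *)
Lemma prod_swap_lists k N x y : 0 < x <= k.+1 -> k.+1 < y < k.+2 + k.+1 ->
  \prod_(l <- swap_lists k N) (k.+1 - ((x \in l) + (y \in l))) =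
  swap_weight k ^ N.
Proof.
move=> xP yP.
rewrite big_flatten big_nseq iter_muln_1; congr (_ ^ _).
rewrite big_allpairs_dep.
have xA : x \in iota 1 k.+1 by rewrite mem_iota; lia.
have yB : y \in iota k.+2 k.+1 by rewrite mem_iota; lia.
have row d : \prod_(b <- iota k.+2 k.+1) (if b == y then d.-1 else d)
    = d.-1 * d ^ k by rewrite prod_one_exception ?iota_uniq // size_iota.
transitivity (\prod_(a <- iota 1 k.+1)
    if a == x then k * k.+1 ^ k else k.-1 * k ^ k); last first.
  by rewrite prod_one_exception ?iota_uniq // size_iota.
rewrite big_seq [RHS]big_seq; apply: eq_bigr => a; rewrite mem_iota => aA.
have -> : (if a == x then k * k.+1 ^ k else k.-1 * k ^ k) =
  \prod_(b <- iota k.+2 k.+1) (if b == y then (k + (a == x)).-1 else k + (a == x)).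
  by rewrite row; case: eqP; rewrite ?addn0 ?addn1.
rewrite big_seq [RHS]big_seq; apply: eq_bigr => b; rewrite mem_iota => bB.
rewrite !in_fset1U !in_fsetD1 !mem_palette xP.
have -> : (x == b) = false by lia.
have -> : (0 < y <= k.+1) = false by lia.
rewrite andbT andbF orbF [x == a]eq_sym [y == b]eq_sym.
by case: (a == x); case: (b == y); rewrite /= ?addn0 ?addn1 ?subn0 ?subn1 ?subn2.
Qed.

(** * Growth comparison and conclusion *)

Lemma exp_dominates C a b n : 0 < a < b -> C * a <= n -> C * a ^ n < b ^ n.
Proof.
move=> /andP[a0 ab] Can.
(* Bernoulli's inequality (b/a)^m >= 1 + m/a, cleared of denominators; at m = n >= C * a it gives
   (b/a)^n >= C + 1. *)
have bern m : a ^ m * (a + m) <= b ^ m * a.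
  elim: m => [|m IHm]; first by rewrite !expn0 addn0.
  rewrite !expnS; apply: (@leq_trans (a.+1 * (a ^ m * (a + m)))); first by lia.
  by rewrite -[b * _ * _]mulnA leq_mul.
have : a * (C.+1 * a ^ n) <= a * b ^ n.
  rewrite [leqRHS]mulnC; apply: leq_trans (bern n).
  by rewrite mulnA mulnC leq_mul2l; apply/orP; right; lia.
rewrite leq_pmul2l // mulSn; apply: leq_trans.
by rewrite -[X in X < _]add0n ltn_add2r expn_gt0 a0.
Qed.

Lemma isomorphic_card (G H : sgraph) : isomorphic G H -> #|G| = #|H|.
Proof. by case=> f [/bij_eq_card]. Qed.

Lemma list_color_fun_leq (G : sgraph) k (L : G -> {fset nat}) :
  k_list_assignment k L -> list_color_fun G k <= nb_list_colorings L.
Proof.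
move=> Lk; rewrite /list_color_fun; case: ex_minnP => m _; apply.
by apply/asboolP; exists L.
Qed.

Lemma list_color_fun_geq (G : sgraph) k m :
  (forall L : G -> {fset nat}, k_list_assignment k L -> m <= nb_list_colorings L) ->
  m <= list_color_fun G k.
Proof.
move=> mP; rewrite /list_color_fun.
by case: ex_minnP => _ /asboolP[L [Lk <-]] _; apply: mP.
Qed.

Lemma list_color_fun_gadget k n :
  list_color_fun (gadget k n) k = chromatic_poly (gadget k n) k.
Proof.
apply/eqP; rewrite eqn_leq list_color_fun_leq ?chromatic_poly_gadget /=.
  by apply: list_color_fun_geq => L /nb_list_colorings_gadget_geq.
exact: palette_list_assignment.
Qed.

(** The first k+2 vertices have at most [k.+1 ^ k.+2] colorings, and each of them extends in the
    same number of ways, whatever the colors of u and w. *)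
Lemma nb_bad_lists_leq k N : 0 < k ->
  nb_list_colorings (fun v : gadget k (N * (k.+1 * k.+1)) => bad_lists k N (val v))
    <= k.+1 ^ k.+2 * swap_weight k ^ N.
Proof.
move=> k_gt0; rewrite (nb_list_colorings_ordered _ (bad_lists k N)).
pose w (s : seq nat) i := let l := nth (palette k.+1) (swap_lists k N) i in
  k.+1 - ((nth 0 s k.-1 \in l) + (nth 0 s k.+1 \in l)).
have memu s : k.+2 <= size s -> valid (nbrs k) (bad_lists k N) s ->
    0 < nth 0 s k.-1 <= k.+1.
  move=> sk /valid_mem => /(_ k.-1); rewrite /bad_lists ifT; last lia.
  by rewrite mem_palette; apply; lia.
have memw s : k.+2 <= size s -> valid (nbrs k) (bad_lists k N) s ->
    k.+1 < nth 0 s k.+1 < k.+2 + k.+1.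
  move=> sk /valid_mem => /(_ k.+1 sk).
  by rewrite /bad_lists ltnn eqxx !inE mem_iota; lia.
rewrite (@size_colorings_extend _ _ _ _ w) => [|s i _ si vs]; last first.
  have sk : k.+2 <= size s by lia.
  rewrite /w !nth_take; try lia.
  rewrite -bad_lists_swap /choices si nbrs_join.
  set l := bad_lists k N _; set x := nth 0 s k.-1; set y := nth 0 s k.+1.
  (* The lists of u and w are disjoint, so their colors differ and each one lying in [l] costs a
     separate choice. *)
  have uxy : uniq [:: x; y].
    by rewrite /= inE andbT neq_ltn; have := memu s sk vs; have := memw s sk vs; lia.
  have := size_filter_notin (fset_uniq l) uxy.
  rewrite (proj2 (bad_listsP k N _)) => /(canRL (addnK _)) ->.
  by rewrite size_filter /= addn0.
rewrite (_ : \sum_(s <- _) _ =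
  \sum_(s <- colorings (nbrs k) (bad_lists k N) k.+2) swap_weight k ^ N).
  rewrite big_const_seq count_predT iter_addn_0 mulnC leq_mul2r.
  rewrite -[in k.+1 ^ _](card_ord k.+2) -prod_nat_const; apply/orP; right.
  apply: (size_colorings_leq (d := fun=> k.+1)) => s _ _.
  rewrite -(proj2 (bad_listsP k N (size s))) size_filter.
  exact: count_size.
rewrite big_seq [RHS]big_seq; apply: eq_bigr => s /mem_colorings[sk vs].
rewrite -(prod_swap_lists _ (memu s _ vs) (memw s _ vs)) ?sk //.
by rewrite (big_nth (palette k.+1)) big_mkord size_swap_lists.
Qed.

Theorem theorem6 (k : nat) (hk : 3 <= k) :
  exists G : nat -> sgraph,
    (forall i : nat,
       [/\ chromatic_poly (G i) k = list_color_fun (G i) k,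
           0 < list_color_fun (G i) k
         & list_color_fun (G i) (k + 1) < chromatic_poly (G i) (k + 1)]) /\
    (forall i j : nat, i <> j -> ~ isomorphic (G i) (G j)).
Proof.
(* The first summand is the threshold [C * a] of [exp_dominates], with C bounding the colorings of
   the first k+2 vertices and a the weight of one round. The summand [i] makes the numbers of
   vertices distinct, so no two of the graphs are isomorphic. *)
pose N i := k.+1 ^ k.+2 * swap_weight k + i.
exists (fun i => gadget k (N i * (k.+1 * k.+1))); split=> [i | i j nij]; last first.
  move/isomorphic_card; rewrite !card_ord => /addnI/eqP.
  by rewrite eqn_pmul2r // => /eqP/addnI.
split; rewrite ?list_color_fun_gadget //.
  rewrite chromatic_poly_gadget prodn_gt0 // => j.
  by rewrite subn_gt0 size_nbrs_lt.
rewrite addn1.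
have bad : k_list_assignment k.+1 (fun v : gadget k (N i * (k.+1 * k.+1)) =>
    bad_lists k (N i) (val v)) by move=> v; exact: bad_listsP.
apply: leq_ltn_trans (list_color_fun_leq bad) _.
apply: leq_ltn_trans (nb_bad_lists_leq _ _) _; first lia.
apply: leq_trans (chromatic_poly_gadgetS_geq _ _); last lia.
rewrite [N i * _]mulnC expnM; apply: exp_dominates; last by rewrite leq_addr.
by apply: swap_weight_lt; lia.
Qed.
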